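(* Let $R$ be a commutative ring with unit and $n\geq0$ an integer. Let $G$ and $H$ be two countable discrete groups. Assume that $G$ and $H$ are coarsely equivalent. Then $G$ is of type $FP_n$ over $R$ if and only if $H$ is of type $FP_n$ over $R$.
   Context: A map $\varphi:G\to H$ is a coarse map if it has finite point preimages and for every $S\subseteq G\times G$ with $\{st^{-1}:(s,t)\in S\}$ finite, $\{\varphi(s)\varphi(t)^{-1}:(s,t)\in S\}$ is finite. Maps $\varphi,\phi:G\to H$ are close ($\sim$) if $\{\varphi(x)\phi(x)^{-1}:x\in G\}$ is finite. $G$ and $H$ are coarsely equivalent if there are coarse maps $\varphi:G\to H$, $\psi:H\to G$ with $\psi\circ\varphi\sim\mathrm{id}_G$ and $\varphi\circ\psi\sim\mathrm{id}_H$. A group $G$ is of type $FP_n$ over $R$ if the trivial $RG$-module $R$ has a projective resolution $\dots\to P_1\to P_0\to R\to0$ with $P_i$ finitely generated for all $0\le i\le n$. *)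

(* Defs.v *)
From HB Require Import structures.
From mathcomp Require Import all_boot all_order all_algebra.
From mathcomp Require Import finmap monalg.
From mathcomp Require Import boolp classical_sets functions cardinality.

Set Implicit Arguments.
Unset Strict Implicit.
Unset Printing Implicit Defensive.

Import GRing.Theory.

Section Coarse.
Local Open Scope classical_set_scope.
Local Open Scope group_scope.

Definition is_coarse_map (G H : groupType) (phi : G -> H) : Prop :=
  (forall y : H, finite_set [set x : G | phi x = y]) /\
  (forall S : set (G * G),
     finite_set [set p.1 * p.2^-1 | p in S] ->
     finite_set [set phi p.1 * (phi p.2)^-1 | p in S]).

Definition close_maps (G H : groupType) (phi psi : G -> H) : Prop :=
  finite_set [set phi x * (psi x)^-1 | x in [set: G]].

Definition coarsely_equivalent (G H : groupType) : Prop :=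
  exists (phi : G -> H) (psi : H -> G),
    [/\ is_coarse_map phi, is_coarse_map psi,
        close_maps (psi \o phi) id & close_maps (phi \o psi) id].

End Coarse.

Local Open Scope fset_scope.
Local Open Scope ring_scope.

(* The multiplication that monalg puts on {malg R[K]} requires x * y = 1 to
   force x = y = 1 in K, so it never applies to a nontrivial group; only the
   additive structure is reused.  R may be the zero ring. *)
Definition group_ring (R : pzRingType) (G : groupType) : Type := {malg R[G]}.

HB.instance Definition _ (R : pzRingType) (G : groupType) :=
  GRing.Zmodule.on (group_ring R G).

Section GroupRing.
Variables (R : pzRingType) (G : groupType).
Implicit Types (a b c : group_ring R G) (g h : G) (r s : R).

Definition gr_one : group_ring R G := mkmalgU (1%g : G) (1 : R).

Definition gr_mul a b : group_ring R G :=
  \sum_(g <- msupp a) \sum_(h <- msupp b) mkmalgU (g * h)%g (a@_g * b@_h).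

Definition gr_aug a : R := \sum_(g <- msupp a) a@_g.

Lemma gr_mulw (d1 d2 : {fset G}) a b :
  msupp a `<=` d1 -> msupp b `<=` d2 ->
  gr_mul a b =
    \sum_(g <- d1) \sum_(h <- d2) mkmalgU (g * h)%g (a@_g * b@_h).
Proof.
move=> le_d1 le_d2; rewrite /gr_mul (big_fset_incl _ le_d1) /=.
  apply/eq_bigr=> g _; apply/big_fset_incl => // h _ /mcoeff_outdom ->.
  by rewrite mulr0 monalgU0.
move=> g _ /mcoeff_outdom ag.
by rewrite big1 => // h _; rewrite ag mul0r monalgU0.
Qed.

Lemma gr_mul0l : left_zero 0 gr_mul.
Proof. by move=> a; rewrite /gr_mul msupp0 big_seq_fset0. Qed.

Lemma gr_mul0r : right_zero 0 gr_mul.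
Proof.
by move=> a; rewrite /gr_mul msupp0 big1 // => g _; rewrite big_seq_fset0.
Qed.

Lemma gr_mulUU r s g h :
  gr_mul (mkmalgU g r) (mkmalgU h s) = mkmalgU (g * h)%g (r * s).
Proof. by rewrite (gr_mulw msuppU_le msuppU_le) !big_seq_fset1 !mcoeffUU. Qed.

Lemma gr_mulDl : left_distributive gr_mul +%R.
Proof.
move=> a b c.
rewrite (gr_mulw (msuppD_le a b) (fsubset_refl (msupp c))).
rewrite (gr_mulw (fsubsetUl (msupp a) (msupp b)) (fsubset_refl (msupp c))).
rewrite (gr_mulw (fsubsetUr (msupp a) (msupp b)) (fsubset_refl (msupp c))).
rewrite -big_split /=; apply/eq_bigr=> g _.
rewrite -big_split /=; apply/eq_bigr=> h _.
by rewrite mcoeffD mulrDl monalgUD.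
Qed.

Lemma gr_mulDr : right_distributive gr_mul +%R.
Proof.
move=> c a b.
rewrite (gr_mulw (fsubset_refl (msupp c)) (msuppD_le a b)).
rewrite (gr_mulw (fsubset_refl (msupp c)) (fsubsetUl (msupp a) (msupp b))).
rewrite (gr_mulw (fsubset_refl (msupp c)) (fsubsetUr (msupp a) (msupp b))).
rewrite -big_split /=; apply/eq_bigr=> g _.
rewrite -big_split /=; apply/eq_bigr=> h _.
by rewrite mcoeffD mulrDr monalgUD.
Qed.

Lemma gr_mul_suml (I : Type) (r : seq I) (F : I -> group_ring R G) a :
  gr_mul (\sum_(i <- r) F i) a = \sum_(i <- r) gr_mul (F i) a.
Proof.
exact: (big_morph (gr_mul^~ a) (fun x y => gr_mulDl x y a) (gr_mul0l a)).
Qed.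

Lemma gr_mul_sumr (I : Type) (r : seq I) (F : I -> group_ring R G) a :
  gr_mul a (\sum_(i <- r) F i) = \sum_(i <- r) gr_mul a (F i).
Proof. exact: (big_morph (gr_mul a) (gr_mulDr a) (gr_mul0r a)). Qed.

Lemma gr_sumE a : a = \sum_(g <- msupp a) mkmalgU g a@_g.
Proof. exact: monalgE. Qed.

Lemma gr_mulA : associative gr_mul.
Proof.
move=> a b c; rewrite {1 2}(gr_sumE a).
set U := fun x g => mkmalgU g x@_g : group_ring R G.
rewrite !(gr_mul_suml (msupp a) (U a)) (gr_mul_suml (msupp a)).
apply: eq_bigr => g _; rewrite {1 2}(gr_sumE b).
rewrite (gr_mul_suml (msupp b) (U b)) (gr_mul_sumr (msupp b) (U b)).
rewrite (gr_mul_sumr (msupp b)) (gr_mul_suml (msupp b)).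
apply: eq_bigr => h _; rewrite {1 2}(gr_sumE c).
rewrite !(gr_mul_sumr (msupp c) (U c)) (gr_mul_sumr (msupp c)).
by apply: eq_bigr => k _; rewrite !gr_mulUU mulrA mulgA.
Qed.

Lemma gr_mul1l : left_id gr_one gr_mul.
Proof.
move=> a; rewrite {1}(gr_sumE a) gr_mul_sumr [RHS]gr_sumE.
by apply: eq_bigr => g _; rewrite gr_mulUU mul1r mul1g.
Qed.

Lemma gr_mul1r : right_id gr_one gr_mul.
Proof.
move=> a; rewrite {1}(gr_sumE a) gr_mul_suml [RHS]gr_sumE.
by apply: eq_bigr => g _; rewrite gr_mulUU mulr1 mulg1.
Qed.

HB.instance Definition _ := GRing.Zmodule_isPzRing.Build (group_ring R G)
  gr_mulA gr_mul1l gr_mul1r gr_mulDl gr_mulDr.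

Lemma gr_augw (d : {fset G}) a :
  msupp a `<=` d -> gr_aug a = \sum_(g <- d) a@_g.
Proof. by move=> le_d; apply: big_fset_incl => // g _ /mcoeff_outdom. Qed.

Lemma gr_augU g r : gr_aug (mkmalgU g r) = r.
Proof. by rewrite (gr_augw msuppU_le) big_seq_fset1 mcoeffUU. Qed.

Lemma gr_aug0 : gr_aug 0 = 0.
Proof. by rewrite /gr_aug msupp0 big_seq_fset0. Qed.

Lemma gr_augD : {morph gr_aug : a b / a + b}.
Proof.
move=> a b; rewrite (gr_augw (msuppD_le a b)).
rewrite (gr_augw (fsubsetUl (msupp a) (msupp b))).
rewrite (gr_augw (fsubsetUr (msupp a) (msupp b))) -big_split /=.
by apply: eq_bigr => g _; rewrite mcoeffD.
Qed.

Lemma gr_aug1 : gr_aug 1 = 1.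
Proof. exact: gr_augU. Qed.

Lemma gr_augM : {morph gr_aug : a b / a * b}.
Proof.
move=> a b; rewrite [in LHS]/GRing.mul /= /gr_mul.
rewrite (big_morph gr_aug gr_augD gr_aug0) [gr_aug a]/gr_aug mulr_suml.
apply: eq_bigr => g _.
rewrite (big_morph gr_aug gr_augD gr_aug0) /gr_aug mulr_sumr.
by apply: eq_bigr => h _; rewrite -/(gr_aug _) gr_augU.
Qed.

End GroupRing.

(* Scaling by a is multiplication by gr_aug a, so each g in G acts as the
   identity on R. *)
Definition triv_module (R : pzRingType) (G : groupType) : Type := R.

HB.instance Definition _ (R : pzRingType) (G : groupType) :=
  GRing.Zmodule.on (triv_module R G).

Section TrivialModule.
Variables (R : pzRingType) (G : groupType).

Definition triv_scale (a : group_ring R G) (x : triv_module R G) :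
  triv_module R G := (gr_aug a * x : R).

Lemma triv_scaleA a b x : triv_scale a (triv_scale b x) = triv_scale (a * b) x.
Proof. by rewrite /triv_scale gr_augM mulrA. Qed.

Lemma triv_scale1 : left_id 1 triv_scale.
Proof. by move=> x; rewrite /triv_scale gr_aug1 mul1r. Qed.

Lemma triv_scaleDr : right_distributive triv_scale +%R.
Proof. by move=> a x y; rewrite /triv_scale mulrDr. Qed.

Lemma triv_scaleDl x : {morph triv_scale^~ x : a b / a + b}.
Proof. by move=> a b; rewrite /triv_scale gr_augD mulrDl. Qed.

HB.instance Definition _ := GRing.Zmodule_isLmodule.Build
  (group_ring R G) (triv_module R G)
  triv_scaleA triv_scale1 triv_scaleDr triv_scaleDl.

End TrivialModule.

Definition fin_gen_module (A : pzRingType) (M : lmodType A) : Prop :=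
  exists (k : nat) (e : 'I_k -> M),
    forall x : M, exists a : 'I_k -> A, x = \sum_(i < k) a i *: e i.

(* Test modules range over all left A-modules whose carrier is a choiceType,
   which is no restriction classically. *)
Definition projective_module (A : pzRingType) (P : lmodType A) : Prop :=
  forall (M N : lmodType A) (q : {linear M -> N}) (f : {linear P -> N}),
    (forall y : N, exists x : M, q x = y) ->
    exists h : {linear P -> M}, forall x : P, q (h x) = f x.

Record proj_resolution (A : pzRingType) (M : lmodType A) : Type :=
  ProjResolution {
    res_mod :> nat -> lmodType A;
    res_diff : forall i : nat, {linear res_mod i.+1 -> res_mod i};
    res_aug : {linear res_mod 0%N -> M};
    res_proj : forall i : nat, projective_module (res_mod i);
    res_aug_surj : forall y : M, exists x : res_mod 0%N, res_aug x = y;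
    res_exact0 : forall x : res_mod 0%N,
      res_aug x = 0 <-> exists y : res_mod 1%N, res_diff 0%N y = x;
    res_exactS : forall (i : nat) (x : res_mod i.+1),
      res_diff i x = 0 <-> exists y : res_mod i.+2, res_diff i.+1 y = x
  }.

Definition type_FP (R : comPzRingType) (n : nat) (G : groupType) : Prop :=
  exists P : proj_resolution (triv_module R G),
    forall i : nat, (i <= n)%N -> fin_gen_module (P i).

(* Main.v *)
(* Being of type FP_n is a coarse property because of Brown's criterion for the
   Rips complexes of G.  For a finite E let the E-chains be the combinations of
   tuples whose entries satisfy x * y^-1 \in E; they form a finitely generated
   submodule of the homogeneous bar complex, and every bar chain is an E-chain
   for some E.  G is of type FP_n iff for every i < n and every E there is an F
   such that each E-cycle in degree i bounds an F-chain.

   Given a resolution P, compare it with the bar resolution C by chain maps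
   f : P -> C and g : C -> P.  If P_(i+1) is finitely generated and z is an
   E-cycle, then g z = d w, and z is the boundary of f w + h z for a homotopy h;
   finite generation of P_(i+1) and of the E-chains bounds the support of
   f w + h z.  Conversely, if P_i is finitely generated and the criterion holds
   in degree i, each cycle z of P_i equals d (h z) + g (f z), where f z = d w
   with w in a finitely generated module, so that the cycles are finitely
   generated; one then builds a resolution choosing a finitely generated cover
   at each step where this is possible.

   The criterion passes to a coarse retract: push an E-cycle forward, fill it,
   pull the filling back, and correct by the prism between the composite map and
   the identity. *)
From HB Require Import structures.
Require Import Defs.
From mathcomp Require Import all_boot all_order all_algebra.
From mathcomp Require Import finmap monalg.
From mathcomp Require Import boolp classical_sets functions cardinality.

Set Implicit Arguments.
Unset Strict Implicit.
Unset Printing Implicit Defensive.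

Import GRing.Theory.

Local Open Scope fset_scope.
Local Open Scope ring_scope.

(** * Free modules and additive extension *)

(* Locked to keep unification from unfolding the chain operations. *)
HB.lock Definition add_ext (K : choiceType) (A V : zmodType)
    (phi : K -> A -> V) (c : {malg A[K]}) : V :=
  \sum_(k <- msupp c) phi k c@_k.

Section AdditiveExtension.
Variables (K : choiceType) (A V : zmodType).
Implicit Types (c d : {malg A[K]}) (k : K) (a : A).

Lemma malg_supp_ind (P : {malg A[K]} -> Prop) c :
  P 0 -> (forall x y, P x -> P y -> P (x + y)) ->
  (forall k a, k \in msupp c -> P (mkmalgU k a)) -> P c.
Proof.
move=> P0 PD PU; rewrite (monalgE c) big_seq.
by apply: big_ind => // k kc; exact: PU.
Qed.

Lemma malg_ind (P : {malg A[K]} -> Prop) :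
  P 0 -> (forall x y, P x -> P y -> P (x + y)) ->
  (forall k a, P (mkmalgU k a)) -> forall c, P c.
Proof. by move=> P0 PD PU c; apply: malg_supp_ind. Qed.

Variable phi : K -> A -> V.
Hypothesis phiD : forall k, {morph phi k : a b / a + b}.

Lemma add_ext_coef0 k : phi k 0 = 0.
Proof. by apply: (addrI (phi k 0)); rewrite -phiD !addr0. Qed.

Lemma add_extEw (s : {fset K}) c :
  msupp c `<=` s -> add_ext phi c = \sum_(k <- s) phi k c@_k.
Proof.
rewrite add_ext.unlock => le_s.
apply: big_fset_incl => // k _ /mcoeff_outdom ->.
exact: add_ext_coef0.
Qed.

Lemma add_extU k a : add_ext phi (mkmalgU k a) = phi k a.
Proof. by rewrite (add_extEw msuppU_le) big_seq_fset1 mcoeffUU. Qed.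

Lemma add_ext0 : add_ext phi 0 = 0.
Proof. by rewrite add_ext.unlock msupp0 big_seq_fset0. Qed.

Lemma add_extD : {morph add_ext phi : c d / c + d}.
Proof.
move=> c d; rewrite (add_extEw (msuppD_le c d)).
rewrite (add_extEw (fsubsetUl (msupp c) (msupp d))).
rewrite (add_extEw (fsubsetUr (msupp c) (msupp d))) -big_split /=.
by apply: eq_bigr => k _; rewrite mcoeffD phiD.
Qed.

Lemma add_ext_nmod_morphism : nmod_morphism (add_ext phi).
Proof. exact: (conj add_ext0 add_extD). Qed.

End AdditiveExtension.

Section LinearMaps.
Variables (A : pzRingType) (U V : lmodType A).

Definition linear_pack (f : U -> V) (fD : {morph f : x y / x + y})
    (fZ : forall a x, f (a *: x) = a *: f x) : {linear U -> V} :=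
  HB.pack f (GRing.isLinear.Build A U V *:%R f
    (fun a x y => etrans (fD (a *: x) y) (congr1 (+%R^~ (f y)) (fZ a x)))).

Lemma exists_linear (f : U -> V) :
  {morph f : x y / x + y} -> (forall a x, f (a *: x) = a *: f x) ->
  exists h : {linear U -> V}, forall x, h x = f x.
Proof. by move=> fD fZ; exists (linear_pack fD fZ). Qed.

End LinearMaps.

Definition free_module (A : pzRingType) (X : choiceType) : Type := {malg A[X]}.

HB.instance Definition _ (A : pzRingType) (X : choiceType) :=
  GRing.Zmodule.on (free_module A X).

Section FreeModule.
Variables (A : pzRingType) (X : choiceType).
Implicit Types (c d : free_module A X) (a b : A) (x : X).

Definition free_elt x a : free_module A X := mkmalgU x a.

Lemma free_eltD x : {morph free_elt x : a b / a + b}.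
Proof. exact: monalgUD. Qed.

Definition free_scale a c : free_module A X :=
  add_ext (fun x b => free_elt x (a * b)) c.

Lemma free_scale_coefD a x :
  {morph (fun b => free_elt x (a * b)) : b c / b + c}.
Proof. by move=> b c; rewrite mulrDr free_eltD. Qed.

Lemma free_scaleU a x b : free_scale a (free_elt x b) = free_elt x (a * b).
Proof. exact: add_extU (free_scale_coefD a) x b. Qed.

Lemma free_scaleDr : right_distributive free_scale +%R.
Proof. move=> a; exact: add_extD (free_scale_coefD a). Qed.

Lemma free_scale_0 a : free_scale a 0 = 0.
Proof. exact: add_ext0. Qed.

Lemma free_scaleA a b c : free_scale a (free_scale b c) = free_scale (a * b) c.
Proof.
elim/malg_ind: c => [|c d IHc IHd|x r]; first by rewrite !free_scale_0.
  by rewrite !free_scaleDr IHc IHd.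
by rewrite -/(free_elt x r) !free_scaleU mulrA.
Qed.

Lemma free_scale1 : left_id 1 free_scale.
Proof.
move=> c; elim/malg_ind: c => [|c d IHc IHd|x r]; first by rewrite free_scale_0.
  by rewrite free_scaleDr IHc IHd.
by rewrite -/(free_elt x r) !free_scaleU mul1r.
Qed.

Lemma free_scaleDl c : {morph free_scale^~ c : a b / a + b}.
Proof.
move=> a b; elim/malg_ind: c => [|c d IHc IHd|x r].
- by rewrite !free_scale_0 addr0.
- by rewrite !free_scaleDr IHc IHd addrACA.
- by rewrite -/(free_elt x r) !free_scaleU mulrDl free_eltD.
Qed.

HB.instance Definition _ := GRing.Zmodule_isLmodule.Build A (free_module A X)
  free_scaleA free_scale1 free_scaleDr free_scaleDl.

Lemma free_eltZ x a : free_elt x a = a *: free_elt x 1.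
Proof. by rewrite -{1}(mulr1 a); exact/esym/free_scaleU. Qed.

Lemma free_ind (P : free_module A X -> Prop) :
  P 0 -> (forall c d, P c -> P d -> P (c + d)) ->
  (forall x a, P (a *: free_elt x 1)) -> forall c, P c.
Proof.
move=> P0 PD PZ; apply: malg_ind => // x a.
by rewrite -[mkmalgU x a]/(free_elt x a) free_eltZ.
Qed.

Lemma free_lin (M : lmodType A) (m : X -> M) :
  exists h : {linear free_module A X -> M},
    forall x, h (free_elt x 1) = m x.
Proof.
pose phi x (a : A) := a *: m x.
have phiD x : {morph phi x : a b / a + b} by move=> a b; exact: scalerDl.
have [a c||h hE] := @exists_linear A (free_module A X) M (add_ext phi).
- exact: add_extD phiD a c.
- move=> a c; elim/malg_ind: c => [|c d IHc IHd|x r].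
  + by rewrite scaler0 !add_ext0 scaler0.
  + by rewrite scalerDr !(add_extD phiD) IHc IHd scalerDr.
  + have -> : a *: (mkmalgU x r : free_module A X) = free_elt x (a * r).
      exact: free_scaleU.
    by rewrite !(add_extU phiD) /phi scalerA.
by exists h => x; rewrite hE (add_extU phiD) /phi scale1r.
Qed.

Lemma free_module_projective : projective_module (free_module A X).
Proof.
move=> M N q f q_surj.
have [m mE] := choice (fun x => q_surj (f (free_elt x 1))).
have [h hE] := free_lin m; exists h => c.
elim/free_ind: c => [|c d IHc IHd|x r]; first by rewrite !linear0.
  by rewrite !linearD IHc IHd.
by rewrite !linearZ hE mE.
Qed.

End FreeModule.

(** [projective_module] lifts only through surjections, while [D] merely hits the image of [f].
    Splitting [P] off the free module on its own elements, and choosing preimages on that basis,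
    avoids forming the image as a module. *)
Lemma projective_lift (A : pzRingType) (P M N : lmodType A)
    (D : {linear M -> N}) (f : {linear P -> N}) :
  projective_module P -> (forall x, exists y, D y = f x) ->
  exists h : {linear P -> M}, forall x, D (h x) = f x.
Proof.
move=> projP lift.
have [q qE] := @free_lin A P P id.
have [x|s sK] := projP _ _ q (idfun : {linear P -> P}).
  by exists (free_elt x 1); rewrite qE.
have [m mE] := choice lift; have [h hE] := free_lin m.
exists (h \o s) => x /=.
have {2}-> : x = q (s x) by rewrite sK.
elim/free_ind: (s x) => [|c d IHc IHd|y r]; first by rewrite !linear0.
  by rewrite !linearD IHc IHd.
by rewrite !linearZ hE qE mE.
Qed.

(** * Spans and resolutions *)

Section Span.
Variables (A : pzRingType) (M : lmodType A).
Implicit Types (L : seq M) (V : M -> Prop).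

Definition submodule V := [/\ V 0, forall x y, V x -> V y -> V (x + y)
  & forall a x, V x -> V (a *: x)].

(** As the intersection of all submodules containing [L], the span carries its own induction
    principle; [span_sum] recovers explicit combinations. *)
Definition span L x :=
  forall V, submodule V -> (forall y, y \in L -> V y) -> V x.

Definition fin_gen_sub (Z : M -> Prop) := exists L,
  (forall y, y \in L -> Z y) /\ (forall x, Z x -> span L x).

Lemma submodule_span L : submodule (span L).
Proof.
split=> [V [] //|x y sx sy V sV LV|a x sx V sV LV].
  by case: (sV) => _ VD _; apply: VD; [exact: sx | exact: sy].
by case: (sV) => _ _ VZ; apply: VZ; exact: sx.
Qed.

Lemma span_mem L x : x \in L -> span L x.
Proof. by move=> xL V _ LV; exact: LV. Qed.

Lemma span_sub L1 L2 x : {subset L1 <= L2} -> span L1 x -> span L2 x.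
Proof.
move=> L12 s1; apply: s1 (submodule_span L2) _ => y /L12; exact: span_mem.
Qed.

Lemma span_sum L x : span L x ->
  exists a : 'I_(size L) -> A, x = \sum_i a i *: L`_i.
Proof.
move=> sx; pose V y := exists a : 'I_(size L) -> A, y = \sum_i a i *: L`_i.
apply: (sx V) => [|y yL]; first split.
- by exists (fun=> 0); rewrite big1 // => i _; rewrite scale0r.
- move=> _ _ [a ->] [b ->]; exists (fun i => a i + b i).
  by rewrite -big_split; apply: eq_bigr => i _; rewrite scalerDl.
- move=> c _ [a ->]; exists (fun i => c * a i).
  by rewrite scaler_sumr; apply: eq_bigr => i _; rewrite scalerA.
have iL : (index y L < size L)%N by rewrite index_mem.
exists (fun i => if i == Ordinal iL then 1 else 0).
rewrite (bigD1 (Ordinal iL)) //= eqxx scale1r nth_index // big1 ?addr0 //.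
by move=> i /negPf ->; rewrite scale0r.
Qed.

Lemma fin_gen_subT : fin_gen_module M <-> fin_gen_sub (fun=> True).
Proof.
split=> [[k [e eE]]|[L [_ LE]]].
  exists [seq e i | i <- enum 'I_k]; split=> // x _; have [a ->] := eE x.
  have [s0 sD sZ] := submodule_span [seq e i | i <- enum 'I_k].
  apply: big_ind => // i _; apply: sZ; apply: span_mem; apply: map_f.
  exact: mem_enum.
by exists (size L), (fun i => L`_i) => x; by apply: span_sum; exact: LE.
Qed.

End Span.

Lemma span_map (A : pzRingType) (M N : lmodType A) (f : {linear M -> N})
  (L : seq M) x : span L x -> span (map f L) (f x).
Proof.
have [s0 sD sZ] := submodule_span (map f L).
move=> sx; pose V y := span (map f L) (f y).
apply: (sx V) => [|y yL]; rewrite /V;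
  first split=> [|y z|a y]; rewrite ?linear0 ?linearD ?linearZ //.
- exact: sD.
- exact: sZ.
- by apply: span_mem; apply: map_f.
Qed.

Arguments span_map {A M N} f {L x}.

Lemma dependent_choice_fam (T : nat -> Type)
    (S : forall i, T i -> T i.+1 -> Prop) (x0 : T 0%N) :
  (forall i (x : T i), exists y, S i x y) ->
  exists2 u : forall i, T i, u 0%N = x0 & forall i, S i (u i) (u i.+1).
Proof.
move=> ex; pose next i x := sval (cid (ex i x)).
pose u := fix u i : T i := if i is j.+1 then next j (u j) else x0.
by exists u => // i; exact: svalP (cid (ex i (u i))).
Qed.

(** * Comparison of projective resolutions *)

Section Resolutions.
Variables (A : pzRingType) (M : lmodType A).
Implicit Types P Q : proj_resolution M.

(** Treating the augmentation as the differential out of degree 0 merges the two exactness axioms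
    into the single [cycleP]. *)
Definition cycle P (i : nat) : P i -> Prop :=
  if i is j.+1 return P i -> Prop then fun x => res_diff P j x = 0
  else fun x => res_aug P x = 0.

Lemma cycleP P i (x : P i) : cycle x <-> exists y, res_diff P i y = x.
Proof. by case: i x => [|i] x; [exact: res_exact0 | exact: res_exactS]. Qed.

Lemma cycle_diff P i (y : P i.+1) : cycle (res_diff P i y).
Proof. by apply/cycleP; exists y. Qed.

Definition chain_map P Q (f : forall i, {linear P i -> Q i}) :=
  (forall x, res_aug Q (f 0%N x) = res_aug P x) /\
  (forall i x, res_diff Q i (f i.+1 x) = f i (res_diff P i x)).

(** The comparison theorem. Each component is carried along with the fact that it preserves cycles,
    which is what makes the next lift possible. *)
Lemma exists_chain_map P Q :
  exists f : forall i, {linear P i -> Q i}, chain_map f.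
Proof.
pose T i := {f : {linear P i -> Q i} | forall x, cycle x -> cycle (f x)}.
have [f0 f0E] : exists f : {linear P 0%N -> Q 0%N},
    forall x, res_aug Q (f x) = res_aug P x.
  have projP := @res_proj _ _ P 0.
  apply: (projective_lift (D := res_aug Q) (f := res_aug P) projP) => x.
  exact: res_aug_surj.
have f0Z (x : P 0%N) : cycle x -> cycle (f0 x) by rewrite /= f0E.
pose S i (f : T i) (f' : T i.+1) := forall x : P i.+1,
  res_diff Q i (sval f' x) = sval f (res_diff P i x).
have [i [f fZ]|u u0 uS] := @dependent_choice_fam T S (exist _ f0 f0Z).
  have [x|h hE] := @projective_lift _ _ _ _ (res_diff Q i)
      (f \o res_diff P i) (@res_proj _ _ P i.+1).
    exact/cycleP/fZ/cycle_diff.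
  by have hZ (x : P i.+1) : cycle x -> cycle (h x);
    [rewrite /= hE /= => ->; exact: linear0 | exists (exist _ h hZ)].
by exists (fun i => sval (u i)); split=> [x|i x]; [rewrite u0 f0E | exact: uS].
Qed.

(** The usual homotopy identity has a further term composed with the differential; it vanishes on
    cycles, so one map per degree suffices. *)
Lemma chain_map_homotopy P (f : forall i, {linear P i -> P i}) :
  chain_map f -> forall i, exists h : {linear P i -> P i.+1},
    forall x, cycle x -> res_diff P i (h x) = x - f i x.
Proof.
move=> [f0 fS]; elim=> [|i [h hE]].
  have [x|h hE] := @projective_lift _ _ _ _ (res_diff P 0)
      (idfun \- f 0%N) (@res_proj _ _ P 0).
    by apply/(cycleP (i := 0)) => /=; rewrite linearB f0 subrr.
  by exists h => x _; exact: hE.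
(* Subtracting [h \o res_diff P i] makes the target a cycle: [hE] applies to [res_diff P i x], which
   is itself a cycle. *)
have [x|h' hE'] := @projective_lift _ _ _ _ (res_diff P i.+1)
    ((idfun \- f i.+1) \- (h \o res_diff P i)) (@res_proj _ _ P i.+1).
  apply/(cycleP (i := i.+1)) => /=.
  by rewrite !linearB /= hE ?fS ?subrr //; exact: cycle_diff.
by exists h' => x /= dx; rewrite hE' /= dx linear0 subr0.
Qed.

Lemma chain_map_cycle P Q (f : forall i, {linear P i -> Q i}) :
  chain_map f -> forall i (x : P i), cycle x -> cycle (f i x).
Proof.
move=> [f0 fS] [|i] x /= dx; first by rewrite f0.
by rewrite fS dx linear0.
Qed.

Lemma chain_map_comp P Q (f : forall i, {linear P i -> Q i})
    (g : forall i, {linear Q i -> P i}) :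
  chain_map f -> chain_map g -> chain_map (fun i => g i \o f i).
Proof.
by move=> [f0 fS] [g0 gS]; split=> [x|i x] /=; rewrite ?g0 ?f0 ?gS ?fS.
Qed.

End Resolutions.

(** * Resolutions by covers that are finitely generated whenever possible *)

Section GreedyResolution.
Variables (A : pzRingType) (M : lmodType A).

(** Bundling both modules with the map gives [iter] a single type to work in. *)
Record linear_arrow := LinearArrow {
  arrow_src : lmodType A;
  arrow_tgt : lmodType A;
  arrow_map : {linear arrow_src -> arrow_tgt} }.

Definition kernel (a : linear_arrow) : arrow_src a -> Prop :=
  fun x => arrow_map a x = 0.

(* The finitely generated cover is taken whenever there is one, so that the
   resolution built from these covers is finitely generated as far as it can
   be. *)
Definition kernel_cover (a : linear_arrow) (X : lmodType A)
    (d : {linear X -> arrow_src a}) :=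
  [/\ projective_module X, forall x, kernel x <-> exists y, d y = x
    & fin_gen_sub (@kernel a) -> fin_gen_module X].

Lemma exists_kernel_cover a :
  exists (X : lmodType A) (d : {linear X -> arrow_src a}), kernel_cover d.
Proof.
have sub_d (Y : choiceType) (m : Y -> arrow_src a)
    (d : {linear free_module A Y -> arrow_src a}) :
    (forall y, kernel (m y)) ->
    (forall y, d (free_elt y 1) = m y) -> forall c, kernel (d c).
  move=> mZ dE c; rewrite /kernel; elim/free_ind: c => [|c c' IHc IHc'|y r].
  - by rewrite !linear0.
  - by rewrite !linearD IHc IHc' addr0.
  - by rewrite !linearZ dE mZ; exact: scaler0.
have [[L [LZ ZL]]|nfg] := pselect (fin_gen_sub (@kernel a)); last first.
  (* Sending elements outside the kernel to 0 lets the basis be the whole source rather than a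
     subtype. *)
  pose m x := if `[< kernel x >] then x else 0 : arrow_src a.
  have [d dE] := free_lin m; exists (free_module A (arrow_src a)), d.
  split=> // [|x]; first exact: free_module_projective.
  split=> [Zx|[y <-]].
    by exists (free_elt x 1); rewrite dE /m asboolT.
  apply: (sub_d _ m) => // z; rewrite /m; case: asboolP => // _.
  exact: linear0.
have [d dE] := free_lin (fun i : 'I_(size L) => L`_i).
exists (free_module A 'I_(size L)), d; split=> [|x|_].
- exact: free_module_projective.
- split=> [/ZL sx|[y <-]].
    have [b ->] := span_sum sx.
    exists (\sum_i b i *: free_elt i 1).
    by rewrite linear_sum; apply: eq_bigr => i _; rewrite linearZ dE.
  by apply: (sub_d _ (fun i : 'I_(size L) => L`_i)) => // i; apply/LZ/mem_nth.
apply/fin_gen_subT; pose e (i : 'I_(size L)) := free_elt i (1 : A).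
exists [seq e i | i <- enum 'I_(size L)]; split=> // c _.
have [s0 sD sZ] := submodule_span [seq e i | i <- enum 'I_(size L)].
elim/free_ind: c => [//|c c'|i r]; first exact: sD.
by apply: sZ; apply: span_mem; apply: map_f; rewrite mem_enum.
Qed.

Definition next_arrow a : linear_arrow :=
  LinearArrow (sval (cid (svalP (cid (exists_kernel_cover a))))).

Lemma next_arrowP a : kernel_cover (arrow_map (next_arrow a)
  : {linear arrow_src (next_arrow a) -> arrow_src a}).
Proof. exact: svalP (cid (svalP (cid (exists_kernel_cover a)))). Qed.

(* Its kernel is all of M, so its cover is the augmentation. *)
Definition zero_arrow : linear_arrow := LinearArrow (\0 : {linear M -> M}).

(** The first iterate is the augmentation, hence [i.+1]: the source of [greedy_arrow i] is the
    module in degree [i], and [greedy_arrow i.+1] is the differential into it. *)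
Definition greedy_arrow i : linear_arrow := iter i.+1 next_arrow zero_arrow.

Lemma greedy_resolution : exists P : proj_resolution M,
  (fin_gen_module M -> fin_gen_module (P 0%N)) /\
  (forall i, fin_gen_sub (@cycle A M P i) -> fin_gen_module (P i.+1)).
Proof.
have [proj0 ex0 fg0] := next_arrowP zero_arrow.
have cov i := next_arrowP (greedy_arrow i).
pose d i : {linear arrow_src (greedy_arrow i.+1) -> arrow_src (greedy_arrow i)}
  := arrow_map (greedy_arrow i.+1).
pose P := @ProjResolution A M
  (fun i => arrow_src (greedy_arrow i)) d (arrow_map (greedy_arrow 0)).
have projP i : projective_module (arrow_src (greedy_arrow i)).
  by case: i => [//|i]; case: (cov i).
have augP y : exists x, arrow_map (greedy_arrow 0) x = y by apply/ex0.
have exP i x : kernel x <-> exists y, d i y = x by case: (cov i).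
have fgP i : fin_gen_sub (@kernel (greedy_arrow i)) ->
  fin_gen_module (arrow_src (greedy_arrow i.+1)) by case: (cov i).
exists (P projP augP (exP 0%N) (fun i => exP i.+1)); split=> [/fin_gen_subT|i].
  by move=> [L [_ ZL]]; apply: fg0; exists L; split=> [y _|x _]; last exact: ZL.
by case: i => [|i]; exact: fgP.
Qed.

End GreedyResolution.

(** * Simplicial chains *)

(** [n] counts vertices: [chain R X n] sits in degree n - 1, and [chain R X 0] is the copy of [R] on
    the empty simplex. Vertices may repeat. *)
Definition chain (R : zmodType) (X : choiceType) (n : nat) : Type :=
  {malg R[n.-tuple X]}.

HB.instance Definition _ (R : zmodType) (X : choiceType) (n : nat) :=
  GRing.Zmodule.on (chain R X n).

Section Chains.
Variables (R : zmodType) (X : choiceType).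
Implicit Types (n : nat) (x : X) (r : R).

Definition simplex n (t : n.-tuple X) r : chain R X n := mkmalgU t r.

Lemma simplexD n (t : n.-tuple X) : {morph simplex t : r s / r + s}.
Proof. exact: monalgUD. Qed.

Lemma simplex_inj n (t : n.-tuple X) : injective (simplex t).
Proof. exact: can_inj (mcoeffUU t). Qed.

Definition cone n x : chain R X n -> chain R X n.+1 :=
  add_ext (fun t r => simplex (cons_tuple x t) r).

Lemma cone_nmod_morphism n x : nmod_morphism (@cone n x).
Proof.
by apply: add_ext_nmod_morphism => t r s; exact: simplexD.
Qed.

HB.instance Definition _ n x := GRing.isNmodMorphism.Build _ _ (@cone n x)
  (@cone_nmod_morphism n x).

Lemma coneD n x : {morph @cone n x : c d / c + d}.
Proof. exact: raddfD. Qed.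

Lemma cone0 n x : @cone n x 0 = 0.
Proof. exact: raddf0. Qed.

Lemma coneB n x : {morph @cone n x : c d / c - d}.
Proof. exact: raddfB. Qed.

Lemma coneU n x (t : n.-tuple X) r :
  cone x (simplex t r) = simplex (cons_tuple x t) r.
Proof. by apply: add_extU => {}t {}r s; exact: simplexD. Qed.

Lemma simplex_ind n (P : chain R X n -> Prop) :
  P 0 -> (forall c d, P c -> P d -> P (c + d)) ->
  (forall t r, P (simplex t r)) -> forall c, P c.
Proof. exact: malg_ind. Qed.

Lemma simplex_eq n (V : zmodType) (f g : {additive chain R X n -> V}) :
  (forall t r, f (simplex t r) = g (simplex t r)) -> f =1 g.
Proof.
move=> fg c; elim/simplex_ind: c => [|c d IHc IHd|//]; first by rewrite !raddf0.
by rewrite !raddfD IHc IHd.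
Qed.

(** Every nonempty tuple is the cone over its tail, so the identities for [bd], [push] and [prism]
    follow by induction from their values on cones, without indexing faces. *)
Lemma cone_eq n (V : zmodType) (f g : {additive chain R X n.+1 -> V}) :
  (forall x c, f (cone x c) = g (cone x c)) -> f =1 g.
Proof.
move=> fg; apply: simplex_eq => t r.
by case/tupleP: t => x t; have := fg x (simplex t r); rewrite coneU.
Qed.

(* Dropping the first vertex, minus the cone from that vertex over the boundary
   of the remaining face, is the alternating sum of the faces; [bd 0] is the
   augmentation onto the empty simplex. *)
Fixpoint simplex_bd n : n.+1.-tuple X -> R -> chain R X n :=
  if n is m.+1 return n.+1.-tuple X -> R -> chain R X n then
    fun t r => simplex (behead_tuple t) r
      - cone (thead t) (@simplex_bd m (behead_tuple t) r)
  else fun=> simplex [tuple].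

Lemma simplex_bdD n (t : n.+1.-tuple X) : {morph simplex_bd t : r s / r + s}.
Proof.
elim: n t => [|n IHn] t r s /=; first exact: simplexD.
by rewrite simplexD IHn raddfD opprD addrACA.
Qed.

Definition bd n : chain R X n.+1 -> chain R X n := add_ext (@simplex_bd n).

Lemma bd_nmod_morphism n : nmod_morphism (@bd n).
Proof. by apply: add_ext_nmod_morphism => t; exact: simplex_bdD. Qed.

HB.instance Definition _ n := GRing.isNmodMorphism.Build _ _ (@bd n)
  (@bd_nmod_morphism n).

Lemma bdB n : {morph @bd n : c d / c - d}.
Proof. exact: raddfB. Qed.

Lemma bdU0 (t : 1.-tuple X) r : bd (simplex t r) = simplex [tuple] r.
Proof. exact: (add_extU (@simplex_bdD 0)). Qed.

Lemma bd_cone0 x (c : chain R X 0) : bd (cone x c) = c.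
Proof.
move: c; apply: (simplex_eq (f := @bd 0 \o cone x) (g := idfun)) => t r /=.
by rewrite coneU bdU0 (tuple0 t).
Qed.

(** Coning from any fixed vertex is a contracting homotopy of the augmented complex. *)
Lemma bd_cone n x (c : chain R X n.+1) : bd (cone x c) = c - cone x (bd c).
Proof.
move: c; apply: (simplex_eq (f := @bd n.+1 \o cone x)
  (g := idfun \- (cone x \o @bd n))) => t r /=.
rewrite coneU /bd (add_extU (@simplex_bdD n.+1)) (add_extU (@simplex_bdD n)) /=.
have -> : behead_tuple (cons_tuple x t) = t by exact: val_inj.
by rewrite theadE.
Qed.

Lemma bd_bd n (c : chain R X n.+2) : bd (bd c) = 0.
Proof.
elim: n => [|n IHn] in c *; move: c;
  apply: (cone_eq (f := @bd _ \o @bd _) (g := \0)) => x c /=;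
  rewrite bd_cone bdB.
  by rewrite bd_cone0 subrr.
by rewrite bd_cone IHn raddf0 subr0 subrr.
Qed.

End Chains.

Section Push.
Variables (R : zmodType) (X Y : choiceType) (f : X -> Y).

Definition push n : chain R X n -> chain R Y n :=
  add_ext (fun t r => simplex (map_tuple f t) r).

Lemma push_nmod_morphism n : nmod_morphism (@push n).
Proof. by apply: add_ext_nmod_morphism => t r s; exact: simplexD. Qed.

HB.instance Definition _ n := GRing.isNmodMorphism.Build _ _ (@push n)
  (@push_nmod_morphism n).

Lemma pushB n : {morph @push n : c d / c - d}.
Proof. exact: raddfB. Qed.

Lemma pushU n (t : n.-tuple X) r :
  push (simplex t r) = simplex (map_tuple f t) r.
Proof. by apply: add_extU => {}t {}r s; exact: simplexD. Qed.

Lemma push_cone n x (c : chain R X n) : push (cone x c) = cone (f x) (push c).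
Proof.
move: c; apply: (simplex_eq (f := @push n.+1 \o cone x)
  (g := cone (f x) \o @push n)) => t r /=.
by rewrite coneU !pushU coneU; congr (simplex _ r); exact: val_inj.
Qed.

Lemma bd_push n (c : chain R X n.+1) : bd (push c) = push (bd c).
Proof.
elim: n => [|n IHn] in c *; move: c;
  apply: (cone_eq (f := @bd _ _ _ \o @push _) (g := @push _ \o @bd _ _ _));
  move=> x c /=; rewrite push_cone.
  by rewrite !bd_cone0.
by rewrite !bd_cone pushB push_cone IHn.
Qed.

End Push.

Lemma push_comp (R : zmodType) (X Y Z : choiceType) (f : X -> Y) (g : Y -> Z) n
  (c : chain R X n) : push g (push f c) = push (g \o f) c.
Proof.
move: c; apply: (simplex_eq (f := @push _ _ _ g _ \o @push _ _ _ f _)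
  (g := @push _ _ _ (g \o f) _)) => t r /=.
rewrite !pushU; congr (simplex _ r).
by apply: val_inj; rewrite /= -map_comp.
Qed.

Lemma push_id (R : zmodType) (X : choiceType) n (c : chain R X n) :
  push id c = c.
Proof.
move: c; apply: (simplex_eq (f := @push _ _ _ id _) (g := idfun)) => t r /=.
by rewrite pushU; congr (simplex _ r); apply: val_inj; exact: map_id.
Qed.

(** * The prism homotopy between two vertex maps *)

Section Prism.
Variables (R : zmodType) (X Y : choiceType) (f g : X -> Y).

(** Unfolded, this is the alternating sum of the tuples (f x_0, ..., f x_i, g x_i, ..., g x_n). *)
Fixpoint simplex_prism n : n.-tuple X -> R -> chain R Y n.+1 :=
  if n is m.+1 return n.-tuple X -> R -> chain R Y n.+1 then
    fun t r => let s := behead_tuple t in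
      cone (f (thead t)) (cone (g (thead t)) (simplex (map_tuple g s) r))
      - cone (f (thead t)) (@simplex_prism m s r)
  else fun _ _ => 0.

Lemma simplex_prismD n (t : n.-tuple X) :
  {morph simplex_prism t : r s / r + s}.
Proof.
elim: n t => [|n IHn] t r s /=; first by rewrite addr0.
by rewrite simplexD IHn !coneD opprD addrACA.
Qed.

Definition prism n : chain R X n -> chain R Y n.+1 :=
  add_ext (@simplex_prism n).

Lemma prism_nmod_morphism n : nmod_morphism (@prism n).
Proof. by apply: add_ext_nmod_morphism => t; exact: simplex_prismD. Qed.

HB.instance Definition _ n := GRing.isNmodMorphism.Build _ _ (@prism n)
  (@prism_nmod_morphism n).

Lemma prismB n : {morph @prism n : c d / c - d}.
Proof. exact: raddfB. Qed.

Lemma prism0 (c : chain R X 0) : prism c = 0.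
Proof.
move: c; apply: (simplex_eq (f := @prism 0) (g := \0)) => t r.
exact: (add_extU (@simplex_prismD 0)).
Qed.

Lemma prism_cone n x (c : chain R X n) :
  prism (cone x c) = cone (f x) (cone (g x) (push g c)) - cone (f x) (prism c).
Proof.
move: c; apply: (simplex_eq (f := @prism n.+1 \o cone x) (g :=
  (cone (f x) \o (cone (g x) \o @push _ _ _ g n)) \- (cone (f x) \o @prism n))).
move=> t r /=.
rewrite coneU /prism !(add_extU (@simplex_prismD _)) pushU /=.
have -> : behead_tuple (cons_tuple x t) = t by exact: val_inj.
by rewrite theadE.
Qed.

Lemma push0 (c : chain R X 0) : push f c = push g c.
Proof.
move: c; apply: (simplex_eq (f := @push _ _ _ f 0) (g := @push _ _ _ g 0)).
move=> t r /=; rewrite !pushU; congr (simplex _ r).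
by rewrite (tuple0 (map_tuple f t)) (tuple0 (map_tuple g t)).
Qed.

(** The cancellation in the inductive step of [bd_prism]: the letter [c] is there the cone from
    [f x] over the [g]-image, which occurs twice and drops out. *)
Lemma zmod_cancel (V : zmodType) (a b c d e t : V) :
  a - (c - d) - (t - (c - b - e)) = a - b - (t - (d - e)).
Proof. by rewrite !opprB !addrA subrK; congr (_ - _ - _); rewrite addrAC. Qed.

Lemma bd_prism n (c : chain R X n.+1) :
  bd (prism c) = push g c - push f c - prism (bd c).
Proof.
elim: n => [|n IHn] in c *; move: c;
  apply: (cone_eq (f := @bd _ _ _ \o @prism _) (g :=
    (@push _ _ _ g _ \- @push _ _ _ f _) \- (@prism _ \o @bd _ _ _))) => x c /=.
  (* Over a single vertex the empty face has zero prism, and both maps agree on it by [push0]. *)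
  rewrite prism_cone bd_cone0 !prism0 cone0 !subr0 bd_cone bd_cone0.
  by rewrite !push_cone push0.
rewrite prism_cone bdB (bd_cone (f x) (cone (g x) (push g c))).
rewrite (bd_cone (g x) (push g c)) (bd_cone (f x) (prism c)) IHn.
rewrite bd_cone prismB prism_cone !push_cone bd_push 3!coneB.
exact: zmod_cancel.
Qed.

End Prism.

(** * Rips chains and coarse maps *)

Section Support.
Variables (R : zmodType) (X : choiceType).

Definition supported n (P : n.-tuple X -> Prop) (c : chain R X n) :=
  forall t, t \in msupp c -> P t.

Lemma supported0 n (P : n.-tuple X -> Prop) : supported P 0.
Proof. by move=> t; rewrite msupp0. Qed.

Lemma supportedD n (P : n.-tuple X -> Prop) c d :
  supported P c -> supported P d -> supported P (c + d).
Proof.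
move=> Pc Pd t /(fsubsetP (msuppD_le _ _)).
by rewrite in_fsetU => /orP[/Pc|/Pd].
Qed.

Lemma supportedB n (P : n.-tuple X -> Prop) c d :
  supported P c -> supported P d -> supported P (c - d).
Proof.
by move=> Pc Pd; apply: supportedD => // t; rewrite msuppN; exact: Pd.
Qed.

Lemma supportedU n (P : n.-tuple X -> Prop) t r :
  P t -> supported P (simplex t r).
Proof.
by move=> Pt s /(fsubsetP msuppU_le); rewrite in_fset1 => /eqP->.
Qed.

Lemma supportedW n (P Q : n.-tuple X -> Prop) c :
  (forall t, P t -> Q t) -> supported P c -> supported Q c.
Proof. by move=> PQ Pc t /Pc/PQ. Qed.

End Support.

Lemma supported_add_ext (R S : zmodType) (X Y : choiceType) m n
    (P : m.-tuple X -> Prop) (Q : n.-tuple Y -> Prop)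
    (phi : m.-tuple X -> R -> chain S Y n) (c : chain R X m) :
  (forall t r, P t -> supported Q (phi t r)) -> supported P c ->
  supported Q (add_ext phi c).
Proof.
move=> PQ Pc; rewrite add_ext.unlock big_seq.
apply: (@big_ind _ (supported Q)) => [||t /Pc Pt].
- exact: supported0.
- exact: supportedD.
- exact: PQ.
Qed.

Section Rips.
Variable R : zmodType.
Implicit Types G H : groupType.

(** Both orders and the case x = y are included, so a nonempty tuple forces 1 into [E]. The
    condition is invariant under right translation. *)
Definition rips G (E : seq G) n (t : n.-tuple G) :=
  forall x y, x \in t -> y \in t -> (x * y^-1)%g \in E.

Definition rips_chain G (E : seq G) n : chain R G n -> Prop :=
  supported (@rips G E n).

Lemma rips_chainW G (E F : seq G) n (c : chain R G n) :
  {subset E <= F} -> rips_chain E c -> rips_chain F c.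
Proof.
by move=> EF; apply: supportedW => t Et x y tx ty; exact/EF/Et.
Qed.

Lemma exists_rips_chain G n (c : chain R G n) : exists E, rips_chain E c.
Proof.
elim/simplex_ind: c => [|c d [E Ec] [F Fd]|t r].
- by exists [::]; exact: supported0.
- exists (E ++ F); apply: supportedD.
    by apply: rips_chainW Ec => x; rewrite mem_cat => ->.
  by apply: rips_chainW Fd => x; rewrite mem_cat orbC => ->.
- exists [seq (x * y^-1)%g | x <- t, y <- t].
  by apply: supportedU => x y tx ty; apply/allpairsP; exists (x, y).
Qed.

Definition bornologous G H (f : G -> H) := forall E : seq G,
  exists F : seq H, forall x y, (x * y^-1)%g \in E -> (f x * (f y)^-1)%g \in F.

Lemma rips_push G H (f : G -> H) (E : seq G) (F : seq H) :
  (forall x y, (x * y^-1)%g \in E -> (f x * (f y)^-1)%g \in F) ->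
  forall n (c : chain R G n), rips_chain E c -> rips_chain F (push f c).
Proof.
move=> EF n c; apply: supported_add_ext => t r Et; apply: supportedU.
by move=> _ _ /mapP[x tx ->] /mapP[y ty ->]; exact/EF/Et.
Qed.

Lemma supported_simplex_prism (X Y : choiceType) (f g : X -> Y) n
    (t : n.-tuple X) (r : R) :
  supported (fun s => {subset s <= map f t ++ map g t})
    (simplex_prism f g t r).
Proof.
have sub_cone (y : Y) m (L L' : seq Y) (c : chain R Y m) :
    y \in L' -> {subset L <= L'} -> supported (fun s => {subset s <= L}) c ->
    supported (fun s => {subset s <= L'}) (cone y c).
  move=> L'y LL'; apply: supported_add_ext => s q sL; apply: supportedU.
  by move=> x; rewrite inE => /predU1P[->//|/sL/LL'].
elim: n t => [|n IHn] t /=; first exact: supported0.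
have [ft gt] : thead t \in t /\ {subset behead t <= t}.
  split=> [|x]; first exact: mem_tnth.
  exact: mem_behead.
have fgt h : (h = f \/ h = g) ->
    {subset map h (behead t) <= map f t ++ map g t}.
  move=> hfg _ /mapP[x /gt tx ->]; rewrite mem_cat.
  by case: hfg => ->; rewrite (map_f _ tx) ?orbT.
apply: supportedB.
  apply: (sub_cone _ _ _ _ _ _ (fun x Lx => Lx)).
    by rewrite mem_cat (map_f f ft).
  apply: (sub_cone _ _ (map g (behead t))).
  - by rewrite mem_cat (map_f g ft) orbT.
  - by apply: fgt; right.
  - exact: supportedU.
apply: (sub_cone _ _ _ _ _ _ _ (IHn _)); first by rewrite mem_cat (map_f f ft).
by move=> x; rewrite mem_cat => /orP[]; apply: fgt; [left | right].
Qed.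

Lemma rips_prism G (f : G -> G) (E K : seq G) :
  (forall x, (f x * x^-1)%g \in K) ->
  exists F, forall n (c : chain R G n),
    rips_chain E c -> rips_chain F (prism f id c).
Proof.
move=> fK; pose K1 := 1%g :: K.
(* This is K1 E K1^-1: each of two prism vertices is within [K1] of a vertex of the original tuple,
   the element 1 of [K1] covering those left in place. *)
exists [seq (a * l^-1)%g | a <- [seq (k * e)%g | k <- K1, e <- E], l <- K1].
move=> n c; apply: supported_add_ext => t r Et.
apply: supportedW (@supported_simplex_prism _ _ f id _ t r) => s st.
have near u : u \in s -> exists2 x, x \in t & (u * x^-1)%g \in K1.
  move=> /st; rewrite mem_cat map_id => /orP[/mapP[x tx ->]|tu].
    by exists x; rewrite // inE fK orbT.
  by exists u; rewrite // mulgV inE eqxx.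
move=> u v /near[x tx Kx] /near[y ty Ky].
have -> : (u * v^-1 = (u * x^-1 * (x * y^-1)) * (v * y^-1)^-1)%g.
  by rewrite invgM invgK !mulgA mulgVK mulgVK.
apply: (allpairs_f (fun a l : G => (a * l^-1)%g)) => //.
by apply: (allpairs_f (fun k e : G => (k * e)%g)) => //; exact: Et.
Qed.

(* The inductive system of the reduced homology groups of the Rips complexes is
   essentially trivial in degree i. *)
Definition fills_cycles G i := forall E : seq G, exists F : seq G,
  forall z : chain R G i.+1, rips_chain E z -> bd z = 0 ->
  exists2 w, rips_chain F w & bd w = z.

Lemma fills_cycles_retract G H i (f : G -> H) (g : H -> G) (K : seq G) :
  bornologous f -> bornologous g -> (forall x, (g (f x) * x^-1)%g \in K) ->
  fills_cycles H i -> fills_cycles G i.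
Proof.
move=> bf bg fK fillH E.
(* [E1] bounds the pushed cycle, [E2] its filling, [E3] the filling pulled back and [E4] the prism;
   all are fixed before the cycle is given. *)
have [E1 EE1] := bf E; have [E2 E12] := fillH E1; have [E3 E23] := bg E2.
have [E4 E4P] := @rips_prism G (g \o f) E K fK.
exists (E3 ++ E4) => z Ez z0.
have [|w E2w wz] := E12 _ (rips_push EE1 Ez).
  by rewrite bd_push z0 raddf0.
exists (push g w + prism (g \o f) id z).
  apply: supportedD.
    apply: rips_chainW (rips_push E23 E2w) => x; rewrite mem_cat => -> //.
  by apply: rips_chainW (E4P _ _ Ez) => x; rewrite mem_cat orbC => ->.
rewrite raddfD /= bd_push wz bd_prism z0 raddf0 subr0 push_id push_comp.
by rewrite addrC subrK.
Qed.

End Rips.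

(** * The bar resolution *)

Section BarModule.
Variables (R : pzRingType) (G : groupType).
Implicit Types (a b : group_ring R G) (g h : G) (r s : R).

Definition gr_elt g r : group_ring R G := mkmalgU g r.

Lemma gr_elt_ind (P : group_ring R G -> Prop) :
  P 0 -> (forall a b, P a -> P b -> P (a + b)) ->
  (forall g r, P (gr_elt g r)) -> forall a, P a.
Proof. exact: malg_ind. Qed.

Lemma gr_eltM g h r s : gr_elt g r * gr_elt h s = gr_elt (g * h)%g (r * s).
Proof. exact: gr_mulUU. Qed.

(* Right translation by the inverse is a left action preserving the quotients
   x * y^-1 that define the coarse structure of G. *)
Definition act g n (t : n.-tuple G) : n.-tuple G :=
  map_tuple (fun x => x * g^-1)%g t.

Lemma actM g h n (t : n.-tuple G) : act (g * h)%g t = act g (act h t).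
Proof.
apply: val_inj; rewrite /= -map_comp; apply: eq_map => x /=.
by rewrite invgM mulgA.
Qed.

Lemma act1 n (t : n.-tuple G) : act 1%g t = t.
Proof.
apply: val_inj; rewrite /= -[RHS]map_id.
by apply: eq_map => x; rewrite invg1 mulg1.
Qed.

Variable n : nat.
Implicit Types c d : chain R G n.

Definition translate g r c : chain R G n :=
  add_ext (fun t s => simplex (act g t) (r * s)) c.

Lemma translate_coefD g r t :
  {morph (fun s => simplex (act g t) (r * s) : chain R G n) : s s' / s + s'}.
Proof. by move=> s s'; rewrite mulrDr simplexD. Qed.

Lemma translateDr g r : {morph translate g r : c d / c + d}.
Proof. exact: (add_extD (translate_coefD g r)). Qed.

Lemma translate0 g r : translate g r 0 = 0.
Proof. exact: add_ext0. Qed.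

Lemma translateU g r t s :
  translate g r (simplex t s) = simplex (act g t) (r * s).
Proof. exact: (add_extU (translate_coefD g r)). Qed.

Lemma translateDl g c : {morph translate g ^~ c : r s / r + s}.
Proof.
move=> r s; elim/simplex_ind: c => [|c d IHc IHd|t q].
- by rewrite !translate0 addr0.
- by rewrite !translateDr IHc IHd addrACA.
- by rewrite !translateU mulrDl simplexD.
Qed.

Definition bar_scale a c : chain R G n :=
  add_ext (fun g r => translate g r c) a.

Lemma bar_scaleDl c : {morph bar_scale^~ c : a b / a + b}.
Proof. by apply: add_extD => g; exact: translateDl. Qed.

Lemma bar_scale0l c : bar_scale 0 c = 0.
Proof. exact: add_ext0. Qed.

Lemma bar_scaleUl g r c : bar_scale (gr_elt g r) c = translate g r c.
Proof. by apply: add_extU => h; exact: translateDl. Qed.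

Lemma bar_scaleDr : right_distributive bar_scale +%R.
Proof.
move=> a c d; elim/gr_elt_ind: a => [|a b IHa IHb|g r].
- by rewrite !bar_scale0l addr0.
- by rewrite !bar_scaleDl IHa IHb addrACA.
- by rewrite !bar_scaleUl translateDr.
Qed.

Lemma bar_scale0r a : bar_scale a 0 = 0.
Proof. by apply: (addrI (bar_scale a 0)); rewrite -bar_scaleDr !addr0. Qed.

Lemma bar_scaleA a b c : bar_scale a (bar_scale b c) = bar_scale (a * b) c.
Proof.
elim/gr_elt_ind: a => [|a a' IHa IHa'|g r].
- by rewrite mul0r !bar_scale0l.
- by rewrite mulrDl !bar_scaleDl IHa IHa'.
elim/gr_elt_ind: b => [|b b' IHb IHb'|h s].
- by rewrite mulr0 !bar_scale0l bar_scale0r.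
- by rewrite mulrDr !bar_scaleDl bar_scaleDr IHb IHb'.
rewrite gr_eltM !bar_scaleUl; elim/simplex_ind: c => [|c d IHc IHd|t q].
- by rewrite !translate0.
- by rewrite !translateDr IHc IHd.
- by rewrite !translateU actM mulrA.
Qed.

Lemma bar_scale1 : left_id 1 bar_scale.
Proof.
move=> c; rewrite -[1]/(gr_elt 1%g 1) bar_scaleUl.
elim/simplex_ind: c => [|c d IHc IHd|t q]; first by rewrite translate0.
  by rewrite translateDr IHc IHd.
by rewrite translateU act1 mul1r.
Qed.

End BarModule.

HB.instance Definition _ (R : pzRingType) (G : groupType) (n : nat) :=
  GRing.Zmodule_isLmodule.Build (group_ring R G) (chain R G n)
    (@bar_scaleA R G n) (@bar_scale1 R G n) (@bar_scaleDr R G n)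
    (@bar_scaleDl R G n).

Section BarResolution.
Variables (R : pzRingType) (G : groupType).
Implicit Types (a b : group_ring R G) (g h : G) (r s : R) (n : nat).

Lemma simplexZ g r n (t : n.-tuple G) s :
  gr_elt g r *: simplex t s = simplex (act g t) (r * s).
Proof. by rewrite -translateU; exact: bar_scaleUl. Qed.

Lemma bar_scalable n (M : lmodType (group_ring R G))
    (f : {additive chain R G n -> M}) :
  (forall g r t s,
    f (gr_elt g r *: simplex t s) = gr_elt g r *: f (simplex t s)) ->
  forall a c, f (a *: c) = a *: f c.
Proof.
move=> fZ a c; elim/simplex_ind: c => [|c d IHc IHd|t s].
- by rewrite scaler0 raddf0 scaler0.
- by rewrite scalerDr !(raddfD f) scalerDr IHc IHd.
elim/gr_elt_ind: a => [|a a' IHa IHa'|g r]; last exact: fZ.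
- by rewrite !scale0r raddf0.
- by rewrite !scalerDl raddfD IHa IHa'.
Qed.

(** The cone is not equivariant, since a translation moves the apex too. In [bdZ] the apex moves in
    step with its base, so the boundary is equivariant nonetheless. *)
Lemma cone_translate n x g r (c : chain R G n) :
  cone (x * g^-1)%g (gr_elt g r *: c) = gr_elt g r *: cone x c.
Proof.
elim/simplex_ind: c => [|c d IHc IHd|t s].
- by rewrite !(scaler0, cone0).
- by rewrite !(scalerDr, coneD) IHc IHd.
rewrite simplexZ !coneU simplexZ; congr simplex.
exact: val_inj.
Qed.

Lemma bdZ n a (c : chain R G n.+1) : bd (a *: c) = a *: bd c.
Proof.
elim: n a c => [|n IHn]; apply: (bar_scalable (f := @bd R G _)) => g r t s /=;
  case/tupleP: t => x t; rewrite -coneU -cone_translate.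
  by rewrite !bd_cone0.
by rewrite !bd_cone IHn cone_translate scalerBr.
Qed.

Definition bar_diff n : {linear chain R G n.+1 -> chain R G n} :=
  linear_pack (raddfD (@bd R G n)) (@bdZ n).

(** The action on nonempty tuples is free, and each orbit contains exactly one tuple beginning with
    1; the lift is prescribed there and translated. This takes at least one vertex, whence
    [n.+1]. *)
Lemma bar_projective n : projective_module (chain R G n.+1).
Proof.
move=> M N q f q_surj.
have [m mE] := choice (fun t => q_surj (f (simplex t 1))).
pose phi (t : n.+1.-tuple G) r : M :=
  gr_elt (thead t)^-1%g r *: m (act (thead t) t).
have phiD t : {morph phi t : r s / r + s}.
  by move=> r s; rewrite -scalerDl; congr (_ *: _); exact: monalgUD.
have [c d|a c|h hE] := @exists_linear _ (chain R G n.+1) M (add_ext phi).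
- exact: (add_extD phiD).
- move: a c; pose ext : {additive chain R G n.+1 -> M} :=
    HB.pack (add_ext phi) (GRing.isNmodMorphism.Build _ _ (add_ext phi)
      (add_ext_nmod_morphism phiD)).
  apply: (bar_scalable (f := ext)) => g r t s /=.
  rewrite simplexZ !(add_extU phiD) /phi scalerA gr_eltM.
  (* [t] and [act g t] share their normalised tuple, and the leading factors differ by [g]. *)
  have -> : thead (act g t) = (thead t * g^-1)%g by rewrite /thead tnth_map.
  by rewrite invgM invgK -actM mulgVK.
exists h => c; rewrite hE.
elim/simplex_ind: c => [|c d IHc IHd|t r].
- by rewrite add_ext0 !linear0.
- by rewrite (add_extD phiD) !linearD IHc IHd.
rewrite (add_extU phiD) linearZ mE -linearZ simplexZ -actM mulVg act1.
by rewrite mulr1.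
Qed.

(** The boundary of a one-vertex chain lands on the empty simplex, a copy of [R] under another type;
    the resolution requires this map with values in [triv_module R G]. *)
Lemma bar_aug_exists : exists f : {linear chain R G 1 -> triv_module R G},
  forall c, bd c = simplex [tuple] (f c : R).
Proof.
pose coef (t : 1.-tuple G) (r : R) := r : triv_module R G.
have coefD t : {morph coef t : r s / r + s} by [].
have [c d|a c|f fE] :=
  @exists_linear _ (chain R G 1) (triv_module R G) (add_ext coef).
- exact: (add_extD coefD).
- move: a c; pose ext : {additive chain R G 1 -> triv_module R G} :=
    HB.pack (add_ext coef) (GRing.isNmodMorphism.Build _ _ (add_ext coef)
      (add_ext_nmod_morphism coefD)).
  apply: (bar_scalable (f := ext)) => g r t s /=.
  rewrite simplexZ !(add_extU coefD) /coef.
  by rewrite -[RHS]/(gr_aug (gr_elt g r) * s) gr_augU.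
exists f => c; rewrite fE.
elim/simplex_ind: c => [|c d IHc IHd|t r].
- by rewrite add_ext0 raddf0 [RHS]monalgU0.
- rewrite (add_extD coefD) (raddfD (@bd R G 0)) /= [bd c]IHc [bd d]IHd.
  exact/esym/simplexD.
by rewrite (add_extU coefD) bdU0.
Qed.

(** The cone from 1 contracts the complex; it is not equivariant, but exactness asks only for a
    preimage. *)
Lemma bd_exact n (c : chain R G n.+1) : bd c = 0 <-> exists d, bd d = c.
Proof.
split=> [c0|[d <-]]; last exact: bd_bd.
by exists (cone 1%g c); rewrite bd_cone c0 cone0 subr0.
Qed.

Definition bar_aug := sval (cid bar_aug_exists).

Lemma bd_bar_aug c : bd c = simplex [tuple] (bar_aug c : R).
Proof. exact: svalP (cid bar_aug_exists) c. Qed.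

Lemma bar_aug_eq0 c : bar_aug c = 0 <-> bd c = 0.
Proof.
rewrite bd_bar_aug; split=> [->|c0]; first exact: monalgU0.
by apply: (@simplex_inj R G 0 [tuple]); rewrite c0; exact/esym/monalgU0.
Qed.

Lemma bar_aug_surj y : exists x, bar_aug x = y.
Proof.
exists (simplex [tuple 1%g] (y : R)).
by apply: (@simplex_inj R G 0 [tuple]); rewrite -bd_bar_aug bdU0.
Qed.

Lemma bar_exact0 x : bar_aug x = 0 <-> exists y, bar_diff 1 y = x.
Proof. by rewrite bar_aug_eq0; exact: bd_exact. Qed.

Definition bar_resolution : proj_resolution (triv_module R G) :=
  @ProjResolution _ _ (fun i => chain R G i.+1) (fun i => bar_diff i.+1)
    bar_aug bar_projective bar_aug_surj bar_exact0
    (fun i => @bd_exact i.+1).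

Lemma bar_cycle i (x : bar_resolution i) : cycle x <-> bd x = 0.
Proof. by case: i x => [|i] x //; exact: bar_aug_eq0. Qed.

End BarResolution.

(** * Brown's criterion *)

Lemma finite_tuples (T : eqType) (E : seq T) n : exists L : seq (n.-tuple T),
  forall t : n.-tuple T, {subset t <= E} -> t \in L.
Proof.
elim: n => [|n [L LP]]; first by exists [:: [tuple]] => t _; rewrite tuple0 inE.
exists [seq cons_tuple x t | x <- E, t <- L] => t.
case/tupleP: t => x t tE.
have -> : [tuple of x :: t] = cons_tuple x t by exact: val_inj.
apply: (allpairs_f (fun (x : T) (t : n.-tuple T) => cons_tuple x t)).
  by apply: tE; rewrite inE eqxx.
by apply: LP => y ty; apply: tE; rewrite inE ty orbT.
Qed.

Section BrownCriterion.
Variables (R : pzRingType) (G : groupType).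
Implicit Types (E F : seq G) (i n : nat).

Lemma rips_act E n (t : n.-tuple G) g : rips E t -> rips E (act g t).
Proof.
move=> Et _ _ /mapP[x tx ->] /mapP[y ty ->].
by rewrite invgM invgK mulgA mulgVK; exact: Et.
Qed.

Lemma rips_chainZ E n a (c : chain R G n) :
  rips_chain E c -> rips_chain E (a *: c).
Proof.
move=> Ec; elim/gr_elt_ind: a => [|a b IHa IHb|g r].
- by rewrite scale0r; exact: supported0.
- by rewrite scalerDl; exact: supportedD.
have -> : gr_elt g r *: c = translate g r c by exact: bar_scaleUl.
apply: supported_add_ext Ec => t s Et.
by apply: supportedU; exact: rips_act.
Qed.

Lemma rips_chain_span E n (L : seq (chain R G n)) c :
  (forall d, d \in L -> rips_chain E d) -> span L c -> rips_chain E c.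
Proof.
move=> LE sc; apply: (sc (@rips_chain R G E n)) => //; split=> [|c1 c2|a c1].
- exact: supported0.
- exact: supportedD.
- exact: rips_chainZ.
Qed.

Lemma rips_chain_seq n (L : seq (chain R G n)) :
  exists E, forall d, d \in L -> rips_chain E d.
Proof.
elim: L => [|c L [E LE]]; first by exists [::].
have [F Fc] := exists_rips_chain c; exists (E ++ F) => d.
rewrite inE => /predU1P[->|/LE Ed].
  by apply: rips_chainW Fc => x; rewrite mem_cat orbC => ->.
by apply: rips_chainW Ed => x; rewrite mem_cat => ->.
Qed.

(** Up to translation a Rips tuple begins with 1, and then all its entries lie in [E], leaving
    finitely many orbits. *)
Lemma rips_chain_fin_gen E n : exists L : seq (chain R G n.+1),
  forall c, rips_chain E c -> span L c.
Proof.
have [T TP] := finite_tuples E n.+1.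
exists [seq simplex t 1 | t <- T] => c Ec.
have [s0 sD sZ] := submodule_span [seq simplex t (1 : R) | t <- T].
set S := [seq simplex t 1 | t <- T] in s0 sD sZ *.
apply: (@malg_supp_ind _ _ (span S) c s0 sD) => t r /Ec Et.
rewrite -[mkmalgU t r]/(simplex t r).
have -> : simplex t r = gr_elt (thead t)^-1%g r *: simplex (act (thead t) t) 1.
  by rewrite simplexZ -actM mulVg act1 mulr1.
apply: sZ; apply: span_mem; apply: map_f; apply: TP => _ /mapP[x tx ->].
by apply: Et => //; exact: mem_tnth.
Qed.

Lemma fills_cycles_of_fin_gen (P : proj_resolution (triv_module R G)) i :
  fin_gen_module (P i.+1) -> fills_cycles R G i.
Proof.
move=> /fin_gen_subT[L [_ LP]] E.
have [f [f0 fS]] := exists_chain_map P (bar_resolution R G).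
have [g [g0 gS]] := exists_chain_map (bar_resolution R G) P.
have [h hE] := chain_map_homotopy
  (chain_map_comp (conj g0 gS) (conj f0 fS)) i.
have [B BE] := rips_chain_fin_gen E i.
(* [F1] bounds [h] on generators of the [E]-chains and [F2] bounds [f i.+1] on generators of
   [P i.+1]. Both precede the choice of a cycle, and such bounds pass to spans. *)
have [F1 F1P] := rips_chain_seq (map h B).
have [F2 F2P] := rips_chain_seq (map (f i.+1) L).
exists (F1 ++ F2) => z Ez z0.
have cz : @cycle _ _ (bar_resolution R G) i z by exact/bar_cycle.
have /cycleP[w dw] := chain_map_cycle (conj g0 gS) cz.
exists (h z + f i.+1 w).
  apply: supportedD.
    apply: (@rips_chainW R G F1) => [x|]; first by rewrite mem_cat => ->.
    exact: rips_chain_span F1P (span_map h (BE _ Ez)).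
  apply: (@rips_chainW R G F2) => [x|]; first by rewrite mem_cat orbC => ->.
  exact: rips_chain_span F2P (span_map (f i.+1) (LP w I)).
rewrite raddfD /=.
have -> : bd (h z) = z - f i (g i z) by exact: hE cz.
have -> : bd (f i.+1 w) = f i (g i z) by rewrite -dw; exact: fS.
exact: subrK.
Qed.

Lemma fin_gen_cycles (P : proj_resolution (triv_module R G)) i :
  fin_gen_module (P i) -> fills_cycles R G i -> fin_gen_sub (@cycle _ _ P i).
Proof.
move=> /fin_gen_subT[L [_ LP]] fill.
have [f [f0 fS]] := exists_chain_map P (bar_resolution R G).
have [g [g0 gS]] := exists_chain_map (bar_resolution R G) P.
have [h hE] := chain_map_homotopy
  (chain_map_comp (conj f0 fS) (conj g0 gS)) i.
have [E EP] := rips_chain_seq (map (f i) L); have [F EF] := fill E.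
have [B BF] := rips_chain_fin_gen F i.+1.
(* Generators of [P i] need not be cycles, but boundaries are. The span of [L1] receives the
   homotopy part of a cycle, that of [L2] the part coming from its filling. *)
pose L1 := map (res_diff P i \o h) L; pose L2 := map (res_diff P i \o g i.+1) B.
exists (L1 ++ L2); split=> [y|z cz].
  by rewrite mem_cat => /orP[]/mapP[x _ ->]; exact: cycle_diff.
have fz0 : bd (f i z) = 0 by apply/bar_cycle/(chain_map_cycle (conj f0 fS)).
have [w Fw wz] := EF _ (rips_chain_span EP (span_map (f i) (LP z I))) fz0.
have [_ sD _] := submodule_span (L1 ++ L2).
have -> : z = res_diff P i (h z) + res_diff P i (g i.+1 w).
  by rewrite hE //= gS /= wz subrK.
apply: sD.
  apply: span_sub (span_map (res_diff P i \o h) (LP z I)) => x.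
  by rewrite mem_cat => ->.
apply: span_sub (span_map (res_diff P i \o g i.+1) (BF w Fw)) => x.
by rewrite mem_cat orbC => ->.
Qed.

Lemma triv_module_fin_gen : fin_gen_module (triv_module R G).
Proof.
exists 1%N, (fun=> 1 : R) => x; exists (fun=> gr_elt 1%g x).
rewrite big_ord1 -[RHS]/(gr_aug (gr_elt 1%g x) * 1).
by rewrite gr_augU mulr1.
Qed.

End BrownCriterion.

Lemma type_FP_fills_cycles (R : comPzRingType) n (G : groupType) :
  type_FP R n G <-> forall i, (i < n)%N -> fills_cycles R G i.
Proof.
split=> [[P fgP] i lt_in|fill].
  exact: fills_cycles_of_fin_gen (fgP _ lt_in).
have [P [fg0 fgS]] := greedy_resolution (triv_module R G).
(* Degree 0 rests on the trivial module alone; degree i + 1 uses filling in degree i, whence the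
   strict bound i < n. *)
exists P; elim=> [_|i IHi lt_in]; first exact/fg0/triv_module_fin_gen.
by apply: fgS; apply: fin_gen_cycles (fill _ lt_in); exact/IHi/ltnW.
Qed.

(** * Coarse invariance of the criterion *)

Lemma coarse_map_bornologous (G H : groupType) (f : G -> H) :
  is_coarse_map f -> bornologous f.
Proof.
move=> [_ fS] E.
(* The largest set of pairs whose quotients lie in [E], so that one finite image serves all pairs at
   once. *)
pose S := [set p : G * G | (p.1 * p.2^-1)%g \in E]%classic.
have [|F FE] := (finite_seqP _).1 (fS S _).
  apply: (@sub_finite_set _ _ [set` E]%classic) => [_ [p Sp <-] //|].
  by apply/finite_seqP; exists E.
exists F => x y Exy; have : [set` F]%classic (f x * (f y)^-1)%g.
  by rewrite -FE; exists (x, y).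
by [].
Qed.

(** Closeness of [g \o f] to the identity makes [G] a coarse retract of [H], with [K] listing the
    errors. *)
Lemma coarse_equivalence_fills_cycles (R : zmodType) (G H : groupType) i :
  coarsely_equivalent G H -> fills_cycles R H i -> fills_cycles R G i.
Proof.
move=> [f [g [cf cg /finite_seqP[K KE] _]]].
apply: (fills_cycles_retract (coarse_map_bornologous cf)
  (coarse_map_bornologous cg) (K := K)) => x.
have : [set` K]%classic ((g \o f) x * (id x)^-1)%g by rewrite -KE; exists x.
by [].
Qed.

Lemma coarsely_equivalent_sym (G H : groupType) :
  coarsely_equivalent G H -> coarsely_equivalent H G.
Proof. by move=> [f [g [cf cg gf fg]]]; exists g, f. Qed.

Theorem corollary4p47 (R : comPzRingType) (n : nat) (G H : groupType)
    (hG : countable [set: G]%classic) (hH : countable [set: H]%classic)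
    (hGH : coarsely_equivalent G H) :
  type_FP R n G <-> type_FP R n H.
Proof.
rewrite !type_FP_fills_cycles; split=> fill i lt_in.
  apply: coarse_equivalence_fills_cycles (fill i lt_in).
  exact: coarsely_equivalent_sym.
exact: coarse_equivalence_fills_cycles hGH (fill i lt_in).
Qed.
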